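(* Let $R$ be a unital $*$-ring and let $p,q\in R$ be projectors with $p-q\in R^\dag$. Then: (1) $(1-pqp)^\dag=p((p-q)^\dag)^2+(1-p)$; (2) $(1-pq)^\dag=p((p-q)^\dag)^2-pq(p-q)^\dag+1-p$; (3) $(p-pqp)^\dag=p((p-q)^\dag)^2$; (4) if $p-pq$ is $*$-cancellable, then $(p-pq)^\dag=(p-q)^\dag p$; (5) if $p-pq$ is $*$-cancellable, then $(p-qp)^\dag=p(p-q)^\dag$.
   Context: A unital $*$-ring is an associative (not necessarily commutative) ring $R$ with unity $1$ and an involution $a\mapsto a^*$ satisfying $(a^* )^*=a$, $(a+b)^*=a^*+b^*$, $(ab)^*=b^*a^*$. An element $a\in R$ is MP-invertible if there is $b\in R$ with $aba=a$, $bab=b$, $(ab)^*=ab$, $(ba)^*=ba$; such $b$ is unique and denoted $a^\dag$ (the Moore-Penrose inverse). $R^\dag$ is the set of MP-invertible elements of $R$. A stated formula for $x^\dag$ asserts that $x\in R^\dag$ and that its Moore-Penrose inverse is the given element. An element $p\in R$ is a projector if $p^2=p=p^*$. An element $a\in R$ is $*$-cancellable if, for all $x\in R$, $a^*ax=0$ implies $ax=0$, and $xaa^*=0$ implies $xa=0$. *)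

(* Defs.v *)
From HB Require Import structures.
From mathcomp Require Import all_boot all_algebra.
From mathcomp Require Import boolp classical_sets.

Set Implicit Arguments.
Unset Strict Implicit.
Unset Printing Implicit Defensive.

Import GRing.Theory.
Local Open Scope ring_scope.

(* Unital *-rings. The base is [pzRingType], so the zero ring is allowed. *)
HB.mixin Record PzRing_hasStar R of GRing.PzRing R := {
  star : R -> R;
  starK : involutive star;
  starD : {morph star : a b / a + b};
  starM : forall a b : R, star (a * b) = star b * star a
}.

#[short(type="starRingType")]
HB.structure Definition StarRing :=
  { R of GRing.PzRing R & PzRing_hasStar R }.

Definition is_mpinv (R : starRingType) (a b : R) : Prop :=
  [/\ a * b * a = a, b * a * b = b,
      star (a * b) = a * b & star (b * a) = b * a].

Definition mp_invertible (R : starRingType) (a : R) : Prop :=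
  exists b : R, is_mpinv a b.

(* The Moore-Penrose inverse of [a], with junk value 0 when [a] has none. *)
Definition mpinv (R : starRingType) (a : R) : R :=
  xget 0 [set b | is_mpinv a b]%classic.

Definition projector (R : starRingType) (p : R) : Prop :=
  p ^+ 2 = p /\ star p = p.

Definition star_cancellable (R : starRingType) (a : R) : Prop :=
  forall x : R, (star a * a * x = 0 -> a * x = 0) /\
                (x * a * star a = 0 -> x * a = 0).

Lemma is_mpinv_unique (R : starRingType) (a b c : R) :
  is_mpinv a b -> is_mpinv a c -> b = c.
Proof.
move=> [ab1 ab2 ab3 ab4] [ac1 ac2 ac3 ac4].
have eab : a * b = a * c.
  by rewrite -ab3 -{1}ac1 -(mulrA (a * c)) starM ab3 ac3 mulrA ab1.
have eba : b * a = c * a.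
  by rewrite -ab4 -{1}ac1 -(mulrA a) mulrA starM ab4 ac4 -mulrA (mulrA a) ab1.
by rewrite -ab2 eba -mulrA eab mulrA ac2.
Qed.

(* [is_mpinv a b] is the assertion that [a] is MP-invertible with inverse [b]. *)
Lemma is_mpinvE (R : starRingType) (a b : R) :
  is_mpinv a b <-> mp_invertible a /\ mpinv a = b.
Proof.
split=> [ab|[[c ac] <-]]; last exact: (xgetPex 0 (ex_intro _ c ac)).
split; first by exists b.
exact: is_mpinv_unique (xgetPex 0 (ex_intro _ b ab)) ab.
Qed.

(* Main.v *)
Require Import Defs.
From mathcomp Require Import all_boot all_algebra.

Import GRing.Theory.
Local Open Scope ring_scope.

(** Put d = p - q, e = d^dag and f = d e. Since d is self-adjoint, so is e, and
    e commutes with d. The square d^2 commutes with p because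
    p d^2 = p - pqp = p d p = d^2 p; hence so do e^2 = (d^2)^dag and
    f = d^2 e^2. Together with p d = d (1 - q), and so p e = e (1 - q), these
    relations reduce every product of an element with its claimed inverse to
    one of the projectors p f, (1 - p) + p f and f (1 - q). Part (5) is the
    adjoint of part (4). *)

Section StarRingTheory.
Variable R : starRingType.
Implicit Types a b c g h : R.

Lemma star0 : star (0 : R) = 0.
Proof. by apply: (addrI (star 0)); rewrite -starD !addr0. Qed.

Lemma starN a : star (- a) = - star a.
Proof. by apply: (addrI (star a)); rewrite -starD !subrr star0. Qed.

Lemma starB a b : star (a - b) = star a - star b.
Proof. by rewrite starD starN. Qed.

Lemma star1 : star (1 : R) = 1.
Proof. by rewrite -[LHS]mulr1 -[X in _ * X]starK -starM mulr1 starK. Qed.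

(** Here [g] and [h] are simplified forms of the two products; self-adjointness and absorption are
    then checked on these forms. *)
Lemma is_mpinv_intro a b g h :
    a * b = g -> b * a = h -> star g = g -> star h = h ->
    g * a = a -> h * b = b ->
  is_mpinv a b.
Proof. by move=> <- <-. Qed.

Lemma is_mpinv_star a b : is_mpinv a b -> is_mpinv (star a) (star b).
Proof.
move=> [aba bab sab sba]; split; rewrite -!starM ?starK //.
- by rewrite mulrA aba.
- by rewrite mulrA bab.
Qed.

(* The hypotheses say that b is the group inverse of a. *)
Lemma group_inverse_comm a b c :
    a * b = b * a -> a * b * a = a -> b * a * b = b -> c * a = a * c ->
  c * b = b * c.
Proof.
move=> ab aba bab ca.
(* Both [c * (a * b)] and [a * b * c] equal [a * b * c * (a * b)], so [c] commutes with the
   idempotent [a * b], which can then be inserted next to [b]. *)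
have cf : c * (a * b) = a * b * c * (a * b).
  by rewrite mulrA ca -[in LHS]aba -!mulrA (mulrA c) ca !mulrA.
have fc : a * b * c = a * b * c * (a * b).
  by rewrite ab -[LHS]mulrA -ca -[in LHS]aba -(mulrA a) [c * _]mulrA ca !mulrA.
have cfE : c * (a * b) = a * b * c by rewrite cf -fc.
have fb : a * b * b = b by rewrite ab.
rewrite -[in LHS]fb mulrA cfE ab -!mulrA (mulrA a) -ca -mulrA cfE.
by rewrite !mulrA bab.
Qed.

Section ProjectorDifference.
Variables p q e : R.
Hypotheses (hp : projector p) (hq : projector q) (de : is_mpinv (p - q) e).

Local Notation d := (p - q).
Local Notation f := (d * e).

Let pp : p * p = p. Proof. by case: hp. Qed.
Let qq : q * q = q. Proof. by case: hq. Qed.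
Let sp : star p = p. Proof. by case: hp. Qed.
Let sq : star q = q. Proof. by case: hq. Qed.

Let sd : star d = d. Proof. by rewrite starB sp sq. Qed.

(** As [d] is self-adjoint, [star e] is another Moore-Penrose inverse of [d]; uniqueness
    concludes. *)
Lemma mpinv_diff_self_adjoint : star e = e.
Proof.
by apply: (is_mpinv_unique (a := d) _ de); rewrite -{1}sd; apply: is_mpinv_star.
Qed.
Let se := mpinv_diff_self_adjoint.

Lemma mpinv_diff_comm : e * d = d * e.
Proof. by case: de => _ _ <- _; rewrite starM se sd. Qed.
Let ed := mpinv_diff_comm.

Let fd : f * d = d. Proof. by case: de. Qed.
Let fe : f * e = e. Proof. by rewrite -ed; case: de. Qed.
Let df : d * f = d. Proof. by rewrite -ed mulrA fd. Qed.
Let ef : e * f = e. Proof. by rewrite mulrA ed fe. Qed.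
Let sf : star f = f. Proof. by case: de. Qed.

Lemma proj_mul_diff : p * d = d * (1 - q).
Proof.
by rewrite !mulrBr mulr1 mulrBl pp qq opprB addrA subrK.
Qed.
Let pd := proj_mul_diff.

Lemma diff_mul_proj : d * p = (1 - q) * d.
Proof.
by apply: (can_inj (@starK R)); rewrite !starM sd sp starB star1 sq pd.
Qed.
Let dp := diff_mul_proj.

Lemma proj_diff_proj : p * d * p = p * d ^+ 2.
Proof.
by rewrite expr2 -mulrA dp !mulrA [p * (1 - q)]mulrBr mulr1 [p * d]mulrBr pp.
Qed.
Let pdp := proj_diff_proj.

Lemma proj_comm_diff2 : p * d ^+ 2 = d ^+ 2 * p.
Proof. by rewrite !expr2 mulrA pd -!mulrA dp. Qed.
Let pd2 := proj_comm_diff2.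

Let f2 : d ^+ 2 * e ^+ 2 = f.
Proof. by rewrite !expr2 -mulrA (mulrA d e) fe. Qed.

Let f2' : e ^+ 2 * d ^+ 2 = f.
Proof. by rewrite !expr2 -mulrA (mulrA e d) ed fd ed. Qed.

Lemma proj_comm_mpinv2 : p * e ^+ 2 = e ^+ 2 * p.
Proof.
apply: (group_inverse_comm (d ^+ 2)); rewrite ?f2 ?f2' //.
- by rewrite expr2 mulrA fd.
- by rewrite expr2 mulrA fe.
Qed.
Let pe2 := proj_comm_mpinv2.

Let pf : p * f = f * p.
Proof. by rewrite -f2 mulrA pd2 -mulrA pe2 mulrA. Qed.

Let e2d : e ^+ 2 * d = e.
Proof. by rewrite expr2 -mulrA ed ef. Qed.

(** Write [e] as [e ^+ 2 * d]: [p] passes through [e ^+ 2] unchanged and turns into [1 - q] on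
    crossing [d]. *)
Lemma proj_mul_mpinv : p * e = e * (1 - q).
Proof. by rewrite -e2d mulrA pe2 -mulrA pd mulrA. Qed.
Let pe := proj_mul_mpinv.

Lemma mpinv_mul_proj : e * p = (1 - q) * e.
Proof.
by apply: (can_inj (@starK R)); rewrite !starM se sp starB star1 sq pe.
Qed.
Let ep := mpinv_mul_proj.

Let pep : p * e * p = p * f.
Proof.
rewrite -[in LHS]e2d mulrA pe2 -[X in X * p]mulrA -[LHS]mulrA pdp.
by rewrite mulrA -pe2 -mulrA f2'.
Qed.

Let spf : star (p * f) = p * f. Proof. by rewrite starM sf sp pf. Qed.

Let pfp : p * f * p = p * f. Proof. by rewrite pf -mulrA pp. Qed.

Let pfpM a : p * f * (p * a) = p * (f * a).
Proof. by rewrite [LHS]mulrA pfp -mulrA. Qed.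

Let scpf : star (1 - p + p * f) = 1 - p + p * f.
Proof. by rewrite starD starB star1 sp spf. Qed.

Let pc : (1 - p) * (1 - p) = 1 - p.
Proof. by rewrite mulrBr mulr1 mulrBl pp mul1r subrr subr0. Qed.

Let cp a : (1 - p) * (p * a) = 0.
Proof. by rewrite mulrA mulrBl mul1r pp subrr mul0r. Qed.

(** One cross term dies because [(1 - p) * p = 0]; the other survives as [p * a - p * a * p], since
    [a] need not commute with [p]. *)
Let cornerM a b : (1 - p + p * a) * (1 - p + p * b) =
  1 - p + (p * a - p * a * p + p * a * (p * b)).
Proof.
rewrite mulrDl [(1 - p) * _]mulrDr [p * a * (_ + _)]mulrDr pc cp addr0.
by rewrite [p * a * (1 - p)]mulrBr mulr1.
Qed.

(** This supplies the absorption conditions for both inverses of the form [1 - p + p * a]. *)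
Let cpfM a : f * a = a ->
  (1 - p + p * f) * (1 - p + p * a) = 1 - p + p * a.
Proof. by move=> fa; rewrite cornerM pfpM fa pfp subrr add0r. Qed.

Let fd2 : f * d ^+ 2 = d ^+ 2. Proof. by rewrite expr2 mulrA fd. Qed.
Let fe2 : f * e ^+ 2 = e ^+ 2. Proof. by rewrite expr2 mulrA fe. Qed.
Let ff : f * f = f. Proof. by rewrite mulrA fd. Qed.

Let pd2pe2 : p * d ^+ 2 * (p * e ^+ 2) = p * f.
Proof. by rewrite pd2 -mulrA (mulrA p) pp pe2 mulrA f2 pf. Qed.

Let pe2pd2 : p * e ^+ 2 * (p * d ^+ 2) = p * f.
Proof. by rewrite pe2 -mulrA (mulrA p) pp pd2 mulrA f2' pf. Qed.

Lemma p_sub_pqE : p - p * q = p * d.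
Proof. by rewrite mulrBr pp. Qed.

Lemma p_sub_pqpE : p - p * q * p = p * d ^+ 2.
Proof. by rewrite -pdp mulrBr pp mulrBl pp. Qed.

Lemma is_mpinv_p_sub_pqp : is_mpinv (p - p * q * p) (p * e ^+ 2).
Proof.
rewrite p_sub_pqpE; apply: (is_mpinv_intro _ _ _ _ pd2pe2 pe2pd2) => //.
- by rewrite pfpM fd2.
- by rewrite pfpM fe2.
Qed.

Let cornerM_comm a b : p * a = a * p ->
  (1 - p + p * a) * (1 - p + p * b) = 1 - p + p * a * (p * b).
Proof.
by move=> pa; rewrite cornerM -[p * a * p]mulrA -pa mulrA pp subrr add0r.
Qed.

(** The element splits as [1 - p] plus [p * d ^+ 2]; the first summand is its own inverse and the
    second is inverted by [p * e ^+ 2]. *)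
Lemma is_mpinv_1_sub_pqp : is_mpinv (1 - p * q * p) (p * e ^+ 2 + (1 - p)).
Proof.
have -> : 1 - p * q * p = 1 - p + p * d ^+ 2.
  by rewrite -p_sub_pqpE addrA subrK.
rewrite [p * e ^+ 2 + _]addrC.
apply: (is_mpinv_intro _ _ (1 - p + p * f) (1 - p + p * f)) => //.
- by rewrite cornerM_comm // pd2pe2.
- by rewrite cornerM_comm // pe2pd2.
- exact: cpfM.
- exact: cpfM.
Qed.

Lemma is_mpinv_1_sub_pq :
  is_mpinv (1 - p * q) (p * e ^+ 2 - p * q * e + 1 - p).
Proof.
have -> : 1 - p * q = 1 - p + p * d by rewrite -p_sub_pqE addrA subrK.
(* Substituting [q = p - d] gives [p * q * e = p * e - p * f]. *)
have -> : p * e ^+ 2 - p * q * e + 1 - p = 1 - p + p * (e ^+ 2 - e + f).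
  rewrite -addrA addrC; congr (_ + _).
  rewrite -addrA mulrDr; congr (_ + _).
  by rewrite mulrDr mulrN mulrA mulrBr pp mulrBl addrA addNr add0r.
set x := e ^+ 2 - e + f.
have d2x : d ^+ 2 * x = f - d + d ^+ 2.
  by rewrite /x mulrDr mulrBr f2 expr2 -!mulrA df.
(* Between two factors [p], the terms [- e] and [f] cancel, as [p * e * p = p * f = p * f * p]. *)
have pxp : p * x * p = p * e ^+ 2.
  rewrite /x mulrDr mulrBr mulrDl mulrBl pep pfp subrK.
  by rewrite -[p * e ^+ 2 * p]mulrA -pe2 mulrA pp.
apply: (is_mpinv_intro _ _ (1 - p + p * f) (1 - p + p * f)) => //.
(* The cross term [p * d - p * d ^+ 2] cancels all of [p * d ^+ 2 * x] except [p * f]. *)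
- rewrite cornerM; congr (_ + _).
  rewrite [p * d * (p * x)]mulrA pdp -[p * d ^+ 2 * x]mulrA d2x.
  rewrite [p * (_ + d ^+ 2)]mulrDr [p * (f - d)]mulrBr.
  by rewrite addrC [p * d - _]addrC addrA addrK subrK.
- rewrite cornerM; congr (_ + _).
  rewrite [p * x * (p * d)]mulrA pxp -[_ * d]mulrA e2d.
  rewrite /x [p * (_ + f)]mulrDr [p * (_ - e)]mulrBr.
  by rewrite [p * e ^+ 2 - p * e + _]addrAC [LHS]addrAC subrK addrC addKr.
- exact: cpfM.
- by apply: cpfM; rewrite mulrDr mulrBr fe2 fe ff.
Qed.

Lemma is_mpinv_p_sub_pq : is_mpinv (p - p * q) (e * p).
Proof.
rewrite p_sub_pqE; apply: (is_mpinv_intro _ _ (p * f) (f * (1 - q))) => //.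
- by rewrite -mulrA (mulrA d) mulrA pfp.
- by rewrite -mulrA (mulrA p) pp pd mulrA ed.
(* Self-adjointness amounts to [f] commuting with [1 - q]: [(1 - q) * d * e = d * p * e = d * e * (1
   - q)]. *)
- by rewrite starM starB star1 sq sf [LHS]mulrA -dp -[LHS]mulrA pe mulrA.
- by rewrite pfpM fd.
- by rewrite -[LHS]mulrA [(1 - q) * _]mulrA -ep -(mulrA e) pp [LHS]mulrA fe.
Qed.

Lemma is_mpinv_p_sub_qp : is_mpinv (p - q * p) (p * e).
Proof.
have := is_mpinv_star _ _ is_mpinv_p_sub_pq.
by rewrite starB !starM sp sq se.
Qed.

End ProjectorDifference.
End StarRingTheory.

Theorem theorem3p9 (R : starRingType) (p q : R)
    (hp : projector p) (hq : projector q) (hpq : mp_invertible (p - q)) :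
  is_mpinv (1 - p * q * p) (p * mpinv (p - q) ^+ 2 + (1 - p)) /\
  is_mpinv (1 - p * q)
    (p * mpinv (p - q) ^+ 2 - p * q * mpinv (p - q) + 1 - p) /\
  is_mpinv (p - p * q * p) (p * mpinv (p - q) ^+ 2) /\
  (star_cancellable (p - p * q) ->
     is_mpinv (p - p * q) (mpinv (p - q) * p)) /\
  (star_cancellable (p - p * q) ->
     is_mpinv (p - q * p) (p * mpinv (p - q))).
Proof.
have de : is_mpinv (p - q) (mpinv (p - q)) by apply/is_mpinvE.
split; first exact: is_mpinv_1_sub_pqp.
split; first exact: is_mpinv_1_sub_pq.
split; first exact: is_mpinv_p_sub_pqp.
split=> _; first exact: is_mpinv_p_sub_pq.
exact: is_mpinv_p_sub_qp.
Qed.
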